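(* For every integer $n\ge 1$, the polynomial $$A_{n,2}(q)=\sum_{\substack{\sigma\in \mathcal{S}_n(321)\\ \mathrm{des}(\sigma)=2}} q^{\mathrm{maj}(\sigma)}$$ is unimodal; that is, among 321-avoiding permutations of length $n$ with exactly $2$ descents, the major index is distributed unimodally.
   Context: $\mathcal{S}_n(321)$ is the set of permutations $\sigma=(\sigma_1,\dots,\sigma_n)$ of $\{1,\dots,n\}$ avoiding the pattern $321$, i.e. having no indices $a<b<c$ with $\sigma_a>\sigma_b>\sigma_c$. The descent set is $\mathrm{Des}(\sigma)=\{j: 1\le j\le n-1,\ \sigma_j>\sigma_{j+1}\}$, $\mathrm{des}(\sigma)=|\mathrm{Des}(\sigma)|$, and $\mathrm{maj}(\sigma)=\sum_{j\in\mathrm{Des}(\sigma)} j$. A polynomial is unimodal if its sequence of coefficients is weakly increasing up to some index and weakly decreasing afterwards; the zero polynomial is regarded as trivially unimodal. *)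

(* Defs.v *)
From mathcomp Require Import all_boot all_order all_fingroup all_algebra.

Set Implicit Arguments.
Unset Strict Implicit.
Unset Printing Implicit Defensive.

Import Order.TTheory GRing.Theory Num.Theory.

Local Open Scope ring_scope.

(* A permutation of {1, ..., n} is represented by s : 'S_n acting on
   {0, ..., n-1}: sigma_(i+1) = s i + 1. *)

Definition avoids321 (n : nat) (s : 'S_n) : bool :=
  ~~ [exists a : 'I_n, exists b : 'I_n, exists c : 'I_n,
       [&& (a < b)%N, (b < c)%N, (s b < s a)%N & (s c < s b)%N]].

(* The value of j : 'I_n is the 1-based position of the descent: if j = i + 1
   then sigma_j = s i + 1 and sigma_(j+1) = s j + 1.  Since j is a successor
   and j < n, the positions range over {1, ..., n-1}. *)
Definition Des (n : nat) (s : 'S_n) : {set 'I_n} :=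
  [set j : 'I_n | [exists i : 'I_n, (i.+1 == j :> nat) && (s j < s i)%N]].

Definition des (n : nat) (s : 'S_n) : nat := #|Des s|.

Definition maj (n : nat) (s : 'S_n) : nat := (\sum_(j in Des s) j)%N.

Definition A321 (n k : nat) : {poly int} :=
  \sum_(s : 'S_n | avoids321 s && (des s == k)) 'X^(maj s).

(* Only the coefficients of index < size p, i.e. up to the degree, matter;
   the zero polynomial, of size 0, is unimodal. *)
Definition unimodal (p : {poly int}) : Prop :=
  exists m : nat,
    (forall i : nat, (i.+1 < size p)%N -> (i < m)%N -> p`_i <= p`_i.+1) /\
    (forall i : nat, (i.+1 < size p)%N -> (m <= i)%N -> p`_i.+1 <= p`_i).

(* Main.v *)
Require Import Defs.
From mathcomp Require Import all_boot all_order all_fingroup all_algebra.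
From mathcomp Require Import zify.
Import GRing.Theory.

Set Implicit Arguments.
Unset Strict Implicit.
Unset Printing Implicit Defensive.

(** Labelling each value [u] of a permutation by the number of descents to the
    right of [u] turns permutations with two descents into words on {A, B, C}
    containing AB and BC as subsequences; [maj] becomes the sum of the letters
    (A = 0, B = 1, C = 2), and 321 is avoided when ABC is not a subsequence.
    Row insertion of such a word, read from right to left, gives a semistandard
    tableau [t] with at most two rows and a recording tableau [q]; the condition
    on AB and BC depends on [t] only.  So it suffices to find a shape-preserving
    injection on these tableaux that lowers the sum of the letters by one when
    it exceeds [n]; reversing and complementing words maps the sum [s] to
    [2 n - s], which gives the other half of unimodality. *)

Notation letA := (@Ordinal 3 0 isT).
Notation letB := (@Ordinal 3 1 isT).
Notation letC := (@Ordinal 3 2 isT).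

Lemma letter_ind (P : 'I_3 -> Prop) :
  P letA -> P letB -> P letC -> forall l, P l.
Proof.
move=> PA PB PC [[|[|[|//]]] lt3].
- by have -> : Ordinal lt3 = letA by apply/val_inj.
- by have -> : Ordinal lt3 = letB by apply/val_inj.
- by have -> : Ordinal lt3 = letC by apply/val_inj.
Qed.

(** * Row insertion into two-row tableaux *)

(* [Tab a x y b c] has first row A^a B^x C^y and second row B^b C^c. *)
Variant tab := Tab of nat & nat & nat & nat & nat.

Definition len1 t := let: Tab a x y b c := t in a + x + y.
Definition len2 t := let: Tab a x y b c := t in b + c.

Definition semistandard t :=
  let: Tab a x y b c := t in (b <= a) && (b + c <= a + x).

(* The Boolean tells in which row the new cell appears; [None] means that a
   third row would be needed. *)
Definition insert t (l : 'I_3) : option (tab * bool) :=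
  let: Tab a x y b c := t in
  match val l, x, y, c with
  | 0, x'.+1, _, 0 => Some (Tab a.+1 x' y b.+1 0, true)
  | 0, _.+1, _, _.+1 => None
  | 0, 0, y'.+1, _ => Some (Tab a.+1 0 y' b c.+1, true)
  | 0, 0, 0, _ => Some (Tab a.+1 0 0 b c, false)
  | 1, _, y'.+1, _ => Some (Tab a x.+1 y' b c.+1, true)
  | 1, _, 0, _ => Some (Tab a x.+1 0 b c, false)
  | _, _, _, _ => Some (Tab a x y.+1 b c, false)
  end.

(** Reverse bumping: the last cell of the row named by [r] is removed, and an entry leaving the
    second row displaces the last strictly smaller entry of the first row. *)
Definition extract t (r : bool) : tab * 'I_3 :=
  let: Tab a x y b c := t in
  match r, c, x, y with
  | true, c'.+1, x'.+1, _ => (Tab a x' y.+1 b c', letB)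
  | true, c'.+1, 0, _ => (Tab a.-1 0 y.+1 b c', letA)
  | true, 0, _, _ => (Tab a.-1 x.+1 y b.-1 0, letA)
  | false, _, _, y'.+1 => (Tab a x y' b c, letC)
  | false, _, x'.+1, 0 => (Tab a x' 0 b c, letB)
  | false, _, 0, 0 => (Tab a.-1 0 0 b c, letA)
  end.

Lemma insertK t l t' r : semistandard t -> insert t l = Some (t', r) ->
  [/\ semistandard t', extract t' r = (t, l), len1 t' = len1 t + ~~ r
    & len2 t' = len2 t + r].
Proof.
case: t => a x y b c; elim/letter_ind: l;
  case: x => [|x]; case: y => [|y]; case: c => [|c] //= /andP[h1 h2] [<- <-] /=;
  split=> //; lia.
Qed.

(** The length condition says that the last cell of the row [r] is a removable corner. *)
Lemma extractK t r : semistandard t ->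
    (if r then 0 < len2 t else len2 t < len1 t) ->
  let: (t', l) := extract t r in
  [/\ semistandard t', insert t' l = Some (t, r), len1 t = len1 t' + ~~ r
    & len2 t = len2 t' + r].
Proof.
case: t => a x y b c; case: r;
  case: x => [|x]; case: y => [|y]; case: c => [|c] /= /andP[h1 h2] h3;
  case: a h1 h2 h3 => [|a] /= h1 h2 h3;
  (try by [split=> //; lia]);
  case: b h1 h2 h3 => [|b] /= h1 h2 h3; split=> //; lia.
Qed.

Fixpoint rsk (w : seq 'I_3) : option (tab * seq bool) :=
  if w is l :: w' then
    if rsk w' is Some (t, q) then
      if insert t l is Some (t', r) then Some (t', r :: q) else None
    else None
  else Some (Tab 0 0 0 0 0, [::]).

Fixpoint unrsk t (q : seq bool) : seq 'I_3 :=
  if q is r :: q' then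
    let: (t', l) := extract t r in l :: unrsk t' q'
  else [::].

(** The head of [q] is the latest insertion, so the condition bears on all suffixes; such sequences
    encode standard tableaux with at most two rows. *)
Fixpoint ballot (q : seq bool) :=
  if q is _ :: q' then (count id q <= count negb q) && ballot q' else true.

Lemma ballot_count q : ballot q -> count id q <= count negb q.
Proof. by case: q => //= r q /andP[]. Qed.

Definition recording t q :=
  [/\ len1 t = count negb q, len2 t = count id q & ballot q].

Lemma rskK w t q : rsk w = Some (t, q) ->
  [/\ semistandard t, recording t q & unrsk t q = w].
Proof.
elim: w t q => [|l w IHw] t q /=; first by case=> <- <-.
case: (rsk w) IHw => [[t0 q0]|] // /(_ _ _ erefl) [ss0 [e1 e2 bal] un].
case ins: insert => [[t1 r]|] // [<- <-].
have [ss1 ext r1 r2] := insertK ss0 ins.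
split=> //=; last by rewrite ext un.
have le21 : len2 t1 <= len1 t1.
  by case: {+}t1 ss1 => a x y b c /= /andP[]; lia.
split=> /=; rewrite ?bal ?andbT; lia.
Qed.

Lemma unrskK t q : semistandard t -> recording t q ->
  rsk (unrsk t q) = Some (t, q).
Proof.
elim: q t => [|r q IHq] t ss [/= e1 e2].
  by case: t {ss} e1 e2 => [[|a] [|x] [|y] [|b] [|c]].
move=> /andP[le bal].
have /(extractK ss) : if r then 0 < len2 t else len2 t < len1 t.
  by have := ballot_count bal; case: r {IHq} e1 e2 le => /=; lia.
case: extract => t' l [ss' ins r1 r2].
by rewrite /= IHq ?ins //; split=> //; lia.
Qed.

Lemma size_unrsk t q : size (unrsk t q) = size q.
Proof. by elim: q t => //= r q IHq t; case: extract => t' l /=; rewrite IHq. Qed.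

Definition core t := let: Tab a x y b c := t in [&& 0 < x, 0 < b & 0 < c].

Definition weight t := let: Tab a x y b c := t in x + b + (y + c).*2.

Lemma insert_weight t l t' r : insert t l = Some (t', r) ->
  weight t' = l + weight t.
Proof.
case: t => a x y b c; elim/letter_ind: l;
  case: x => [|x]; case: y => [|y]; case: c => [|c] //= [<- _] /=; lia.
Qed.

Lemma rsk_weight w t q : rsk w = Some (t, q) -> \sum_(l <- w) l = weight t.
Proof.
elim: w t q => [|l w IHw] t q /=; first by case=> <- _; rewrite big_nil.
rewrite big_cons; case: (rsk w) IHw => [[t0 q0]|] // /(_ _ _ erefl) ->.
case ins: insert => [[t1 r]|] // [<- _]; exact/esym/insert_weight/ins.
Qed.

(** Insertion fails exactly when A meets [x > 0] and [c > 0], that is, when BC already occurs and A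
    completes ABC. Membership of B and C is carried along because prepending A or B creates AB or BC
    from a single letter. *)
Lemma rsk_subseq w :
  if rsk w is Some (Tab a x y b c, q) then
    [/\ ~~ subseq [:: letA; letB; letC] w,
        subseq [:: letA; letB] w = (0 < b),
        subseq [:: letB; letC] w = (0 < x) && (0 < c),
        (letB \in w) = (0 < x + b) & (letC \in w) = (0 < y + c)]
  else subseq [:: letA; letB; letC] w.
Proof.
elim: w => [|l w IHw] //.
cbn [rsk]; case: (rsk w) IHw => [[[a x y b c] q]|].
  move=> [h1 h2 h3 h4 h5].
  move: h1 h2 h3; elim/letter_ind: l; rewrite /= ?sub1seq ?h4 ?h5;
    case: x h4 => [|x] h4; case: y h5 => [|y] h5; case: c h5 => [|c] h5 /=;
    rewrite ?inE /= ?h4 ?h5 => h1 h2 h3; rewrite ?h1 ?h2 ?h3; try split; lia.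
move=> h; apply: subseq_trans h _; exact: subseq_cons.
Qed.

(** * Lowering the sum of the entries at constant shape *)

(* With [d] the sum of the entries minus their number, a C of the first row is
   replaced by B when [c < b + d], and otherwise a B of the first row by A.
   The latter is impossible when [x = 1]; such a tableau is sent to one with
   [c' <= b' + (d - 1)] that is not of the form "C replaced by B", because it
   has [x' = 1] (first subcase) or [a' + x' = m] (second subcase).  On the
   second row, the first subcase reflects [b] around [h + 1/2]. *)
Definition lower t :=
  let: Tab a x y b c := t in
  let d := y + c - a in
  let m := b + c in
  let f := (a.*2 + b).+1 - m.*2 in
  let h := (m - d)./2 in
  if c < b + d then Tab a x.+1 y.-1 b c
  else if 1 < x then Tab a.+1 x.-1 y b c
  else if h.*2 <= b + f + 1 then
    let b' := (h.*2).+1 - b in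
    let a' := a + b - h in
    Tab a' 1 (a + x + y - a' - 1) b' (m - b')
  else
    let b' := maxn h f.+2 + b.+1./2 in
    let a' := (a.*2 + b).+2 - (m + b') in
    Tab a' (m - a') (a + x + y - m) b' (m - b').

(* Truncated at 0 if the entries sum to less than their number. *)
Definition excess t := let: Tab a x y b c := t in y + c - a.

Lemma lowerP t : semistandard t -> core t -> 0 < excess t ->
  [/\ semistandard (lower t), core (lower t), len1 (lower t) = len1 t,
      len2 (lower t) = len2 t & weight t = (weight (lower t)).+1].
Proof.
case: t => a x y b c /= /andP[h1 h2] /and3P[h3 h4 h5] h6.
case: ifP => c1 /=; first by split; lia.
case: ifP => c2 /=; first by split; lia.
case: ifP => c3 /=; split; lia.
Qed.

Arguments lower : simpl never.

(** The branches of [lower] as linear relations, without truncated subtraction, ready for pairwise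
    comparison. *)
Lemma lower_cases a x y b c a' x' y' b' c' m d :
    let t := Tab a x y b c in
    semistandard t -> core t -> 0 < d -> y + c = a + d -> b + c = m ->
    lower t = Tab a' x' y' b' c' ->
  [\/ [/\ c < b + d, a' = a, x' = x.+1 & b' = b],
      [/\ b + d <= c, a' = a.+1, x'.+1 = x & b' = b]
    | [/\ b + d <= c, x = 1, b' + c' = m
      & exists f, f + m.*2 = (a.*2 + b).+1 /\
        let h := (m - d)./2 in
        if h.*2 <= b + f + 1 then [/\ a' + h = a + b, x' = 1 & b' + b = h.*2.+1]
        else [/\ a' + (m + b') = (a.*2 + b).+2, a' + x' = m
               & b' = maxn h f.+2 + b.+1./2]]].
Proof.
move=> /= /andP[h1 h2] /and3P[h3 h4 h5] d0 ed em; rewrite /lower.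
have -> : y + c - a = d by lia.
rewrite em; case: ifP => c1; first by case=> <- <- _ <- _; constructor 1; split; lia.
case: ifP => c2; first by case=> <- <- _ <- _; constructor 2; split; lia.
have x1 : x = 1 by lia.
(* The subtraction defining [f] is exact: [x = 1] gives [m <= a + 1], and [b] is positive. *)
have fge : m.*2 <= (a.*2 + b).+1 by lia.
move=> E; constructor 3; split; try lia.
  by move: E; case: ifP => c3 [_ _ _ <- <-]; lia.
exists ((a.*2 + b).+1 - m.*2); split; first by lia.
move: E => /=; case: ifP => c3 [<- <- _ <- _]; split; lia.
Qed.

Lemma lower_inj t1 t2 :
    semistandard t1 -> core t1 -> 0 < excess t1 ->
    semistandard t2 -> core t2 -> excess t2 = excess t1 ->
  lower t1 = lower t2 -> t1 = t2.
Proof.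
move=> s1 k1 d1 s2 k2 d2 e.
have d2' : 0 < excess t2 by rewrite d2.
have [_ _ r1 r2 _] := lowerP s1 k1 d1.
have [_ _] := lowerP s2 k2 d2'; rewrite -e r1 r2 => {}r1 {}r2 _.
move E : (lower t1) e => t' /esym E'; case: t' E E' => a' x' y' b' c' E E'.
case: t1 s1 k1 d1 d2 r1 r2 E => a x y b c s1 k1 /= d1 d2 r1 r2 E.
case: t2 s2 k2 d2 d2' r1 r2 E' => a0 x0 y0 b0 c0 s2 k2 /= d2 d2' r1 r2 E'.
have [d ed ed0] : exists2 d, y + c = a + d & y0 + c0 = a0 + d.
  by exists (y + c - a); lia.
have d_gt0 : 0 < d by lia.
have C1 := lower_cases s1 k1 d_gt0 ed erefl E.
have C2 := lower_cases s2 k2 d_gt0 ed0 (esym r2) E'.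
(* The common row lengths then determine [y] and [c]. *)
suff [? ? ?] : [/\ a = a0, x = x0 & b = b0] by subst; congr Tab; lia.
move: s1 k1 s2 k2 => /= /andP[h1 h2] /and3P[h3 h4 h5] /andP[g1 g2] /and3P[g3 g4 g5].
move: C1 C2; clear E E'; move em : (b + c) => m.
(* The first branch yields [c' < b' + d], the second [b' + d <= c']. Images of the first also have
   [x' > 1] and [a' + x' > m], which excludes both subcases of the third. *)
case=> [[? ? ? ?]|[? ? ? ?]|[? ? ? [f [ef /=]]]]; last case: ifP => c3 [? ? ?].
all: case=> [[? ? ? ?]|[? ? ? ?]|[? ? ? [f0 [ef0 /=]]]]; last case: ifP => c3' [? ? ?].
all: (split; lia).
Qed.

(** * Words *)

Definition admissible (w : seq 'I_3) :=
  [&& subseq [:: letA; letB] w, subseq [:: letB; letC] w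
    & ~~ subseq [:: letA; letB; letC] w].

Lemma admissibleE w :
  admissible w = if rsk w is Some (t, q) then core t else false.
Proof.
have := rsk_subseq w; rewrite /admissible.
case: (rsk w) => [[[a x y b c] q] [-> -> -> _ _]|->] /=; last by rewrite !andbF.
by case: (0 < x); case: (0 < b); case: (0 < c).
Qed.

(** The recording sequence can be kept because [lower] preserves the shape. *)
Definition lower_word (w : seq 'I_3) : seq 'I_3 :=
  if rsk w is Some (t, q) then unrsk (lower t) q else w.

Lemma rsk_size w t q : rsk w = Some (t, q) -> size w = len1 t + len2 t.
Proof.
move=> /rskK[_ [-> -> _] <-]; rewrite size_unrsk addnC.
by rewrite -(count_predC id).
Qed.

Lemma weightE t : len1 t + len2 t < weight t ->
  weight t = len1 t + len2 t + excess t.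
Proof. case: t => a x y b c /=; lia. Qed.

Lemma rsk_lower_word w : admissible w -> size w < \sum_(l <- w) l ->
  exists t q, [/\ rsk w = Some (t, q), rsk (lower_word w) = Some (lower t, q)
    & [/\ semistandard t, core t & \sum_(l <- w) l = size w + excess t]].
Proof.
rewrite admissibleE /lower_word; case E: (rsk w) => [[t q]|] // co.
rewrite (rsk_weight E) (rsk_size E) => lt.
have [ss [e1 e2 bal] _] := rskK E.
have ex : 0 < excess t by have := weightE lt; lia.
have [s1 c1 l1 l2 _] := lowerP ss co ex.
exists t, q; split=> //; last by split=> //; apply: weightE.
by apply: unrskK => //; split; rewrite ?l1 ?l2.
Qed.

Lemma lower_wordP w : admissible w -> size w < \sum_(l <- w) l ->
  [/\ admissible (lower_word w), size (lower_word w) = size w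
    & \sum_(l <- w) l = (\sum_(l <- lower_word w) l).+1].
Proof.
move=> adm lt; have [t [q [E E' [ss co we]]]] := rsk_lower_word adm lt.
have ex : 0 < excess t by lia.
have [s1 c1 l1 l2 e] := lowerP ss co ex.
by rewrite admissibleE E' (rsk_size E') (rsk_weight E') (rsk_weight E) (rsk_size E) l1 l2.
Qed.

(** Equal images share the recording sequence and the lowered tableau; equal sizes and sums give
    equal excess, so [lower_inj] applies. *)
Lemma lower_word_inj w1 w2 :
    admissible w1 -> size w1 < \sum_(l <- w1) l ->
    admissible w2 -> size w2 = size w1 -> \sum_(l <- w2) l = \sum_(l <- w1) l ->
  lower_word w1 = lower_word w2 -> w1 = w2.
Proof.
move=> a1 l1 a2 sz we e.
have l2 : size w2 < \sum_(l <- w2) l by lia.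
have [t1 [q1 [E1 E1' [s1 c1 e1]]]] := rsk_lower_word a1 l1.
have [t2 [q2 [E2 E2' [s2 c2 e2]]]] := rsk_lower_word a2 l2.
move: E2'; rewrite -e E1' => -[el eq].
have et : t1 = t2 by apply: lower_inj => //; lia.
by have [_ _ <-] := rskK E1; have [_ _ <-] := rskK E2; rewrite et eq.
Qed.

Definition words n s : {set n.-tuple 'I_3} :=
  [set w : n.-tuple 'I_3 | admissible w & \sum_(l <- w) l == s].

Lemma card_words_lower n s : n < s -> #|words n s| <= #|words n s.-1|.
Proof.
(* The default [w] is never taken on [words n s], where [lower_word] keeps the size. *)
move=> lt; pose f (w : n.-tuple 'I_3) : n.-tuple 'I_3 := insubd w (lower_word w).
have fE (w : n.-tuple 'I_3) : w \in words n s ->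
  [/\ admissible w, size w < \sum_(l <- w) l & f w = lower_word w :> seq _].
  rewrite inE => /andP[adm /eqP e].
  have ls : size w < \sum_(l <- w) l by rewrite size_tuple e.
  split=> //; rewrite val_insubd.
  by have [_ -> _] := lower_wordP adm ls; rewrite size_tuple eqxx.
have finj : {in words n s &, injective f}.
  move=> w1 w2 i1 i2 e; have [a1 l1 f1] := fE _ i1; have [a2 l2 f2] := fE _ i2.
  apply/val_inj/lower_word_inj => //=; rewrite ?size_tuple //.
    by move: i1 i2; rewrite !inE => /andP[_ /eqP->] /andP[_ /eqP->].
  by rewrite -f1 -f2 e.
rewrite -(card_in_imset finj); apply/subset_leq_card/subsetP => _ /imsetP[w iw ->].
have [a l ef] := fE _ iw; have [a' _ sum] := lower_wordP a l.
by move: iw; rewrite !inE ef a' sum => /andP[_ /eqP<-] /=.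
Qed.

(** * Reverse-complement symmetry of words *)

Definition revcompl (w : seq 'I_3) := rev (map (@rev_ord 3) w).

Lemma revcomplK : involutive revcompl.
Proof.
move=> w; rewrite /revcompl map_rev revK -map_comp map_id_in // => l _ /=.
exact: rev_ordK.
Qed.

Lemma admissible_revcompl w : admissible (revcompl w) = admissible w.
Proof.
have mono s1 s2 : subseq s1 s2 -> subseq (revcompl s1) (revcompl s2).
  by rewrite /revcompl subseq_rev; apply: map_subseq.
have sub s : subseq s (revcompl w) = subseq (revcompl s) w.
  by apply/idP/idP => /mono; rewrite revcomplK.
(* Reverse-complement exchanges AB with BC and fixes ABC. *)
rewrite /admissible !sub andbCA.
by congr [&& subseq _ w, subseq _ w & ~~ subseq _ w]; rewrite /revcompl /rev /=;
  repeat (congr cons; first by apply/val_inj).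
Qed.

Lemma sum_revcompl w : \sum_(l <- revcompl w) l + \sum_(l <- w) l = (size w).*2.
Proof.
rewrite /revcompl big_rev big_map /= -big_split /=.
rewrite (eq_bigr (fun=> 2)) ?big_const_seq ?count_predT ?iter_addn; last first.
  by elim/letter_ind.
lia.
Qed.

Lemma card_words_sym n s : s <= n.*2 -> #|words n s| = #|words n (n.*2 - s)|.
Proof.
suff le s' : s' <= n.*2 -> #|words n s'| <= #|words n (n.*2 - s')|.
  by move=> h; apply/eqP; rewrite eqn_leq le //= -{2}(subKn h) le ?leq_subr.
move=> h; pose f (w : n.-tuple 'I_3) : n.-tuple 'I_3 := [tuple of revcompl w].
have finj : injective f.
  by move=> w1 w2 /(congr1 val)/(can_inj revcomplK)/val_inj.
rewrite -(card_imset _ finj); apply/subset_leq_card/subsetP => _ /imsetP[w iw ->].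
move: iw; rewrite !inE /= admissible_revcompl => /andP[-> /eqP e] /=.
by have := sum_revcompl w; rewrite size_tuple e => <-; rewrite addnK.
Qed.

(** * Permutations and their descent words *)

Lemma card_ord_below n m : m <= n -> #|[set i : 'I_n | i < m]| = m.
Proof.
by move=> le; rewrite -sum1dep_card -(big_ord_widen n (fun=> 1)) // sum1_card card_ord.
Qed.

Section DescentWord.
Variable n : nat.
Implicit Types (s : 'S_n) (p q u v : 'I_n).

(** An element of [Des s] is the 0-based index of a descent bottom, so a descent from [p] to [p + 1]
    is counted. *)
Definition des_after s (p : nat) := #|[set j in Des s | p < j]|.

Lemma des_after_anti s (p q : nat) : p <= q -> des_after s q <= des_after s p.
Proof.
move=> le; apply/subset_leq_card/subsetP => j; rewrite !inE => /andP[-> /=].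
exact: leq_ltn_trans.
Qed.

Lemma des_after_step s p q : p.+1 = q ->
  des_after s p = des_after s q + (s q < s p).
Proof.
move=> pq; have DE : (q \in Des s) = (s q < s p).
  rewrite inE; apply/existsP/idP => [[i /andP[/eqP iq lt]]|lt].
    by have <- : i = p by apply/val_inj/eqP; rewrite -eqSS iq pq.
  by exists p; rewrite pq eqxx.
rewrite /des_after (cardsD1 q) inE DE -[X in _ && (_ < X)]pq ltnSn andbT addnC.
congr (_ + _); apply: eq_card => j; rewrite !in_setD1 !inE.
have -> : (q < j) = (j != q) && (p < j).
  by rewrite -(inj_eq val_inj) /= -pq ltn_neqAle eq_sym.
by rewrite andbCA.
Qed.

Lemma des_after_asc s p q : p < q -> des_after s p <= des_after s q -> s p < s q.
Proof.
move=> lt; have [d qE] : exists d, q = p + d.+1 :> nat.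
  by exists (q - p).-1; lia.
elim: d q qE lt => [|d IHd] q qE lt le.
  have pq : p.+1 = q by lia.
  have step := des_after_step s pq.
  case: (ltngtP (s q) (s p)) => // [h|/val_inj/perm_inj e]; last by subst; lia.
  by rewrite h in step; lia.
have lt' : p + d.+1 < n by have := ltn_ord q; lia.
pose r := Ordinal lt'.
have rq : r.+1 = q by rewrite /=; lia.
have := des_after_step s rq; have pr : p <= r by rewrite /=; lia.
have := des_after_anti s pr; move=> le1 step.
have {le} [le2 nd] : des_after s p <= des_after s r /\ s q < s r = false by lia.
apply: leq_trans (IHd r erefl _ le2) _; first by rewrite /=; lia.
by rewrite leqNgt nd.
Qed.

Lemma des_after0 s : des_after s 0 = des s.
Proof.
apply: eq_card => j; rewrite !inE; apply: andb_idr => /existsP[i /andP[/eqP<-]] //.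
Qed.

Lemma des_after_le s (p : nat) : des_after s p <= des s.
Proof. by rewrite -des_after0 des_after_anti. Qed.

Lemma des_after_last s m : n <= m.+1 -> des_after s m = 0.
Proof.
move=> le; apply: eq_card0 => j; rewrite inE ltnNge -ltnS.
by rewrite (leq_trans (ltn_ord j)) ?andbF.
Qed.

(** Double counting: the descent [j] is counted at exactly the [j] positions below it. *)
Lemma sum_des_after s : \sum_(p : 'I_n) des_after s p = maj s.
Proof.
rewrite /maj (eq_bigr (fun p : 'I_n => \sum_(j in Des s) (p < j))); last first.
  move=> p _; rewrite /des_after -sum1_card big_mkcond [RHS]big_mkcond /=.
  by apply: eq_bigr => j _; rewrite inE; case: (j \in _); case: (p < j).
rewrite exchange_big /=; apply: eq_bigr => j _.
by rewrite -big_mkcond /= sum1dep_card card_ord_below // ltnW.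
Qed.

Lemma descent_le_letters s p q : des_after s p < des_after s q -> q < p.
Proof. by case: (ltnP q p) => // /(des_after_anti s); lia. Qed.

(** * Descent words and their inverse by stable sorting *)

Variable k : nat.
Implicit Types w : n.-tuple 'I_k.+1.

Definition descent_word s : n.-tuple 'I_k.+1 :=
  [tuple inord (des_after s ((s^-1)%g u)) | u < n].

(** The order in which the values appear in the permutation: larger letters first, ties by
    increasing value. *)
Definition before w u v :=
  (tnth w v < tnth w u) || (tnth w u == tnth w v) && (u < v).

(** Some [l] precedes some [l + 1] in the word: exactly what forces a descent where the block of
    [l + 1] meets that of [l] after sorting. *)
Definition full w := [forall l : 'I_k, [exists u : 'I_n, [exists v : 'I_n,
  [&& u < v, tnth w u == l :> nat & tnth w v == l.+1 :> nat]]]].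

Lemma before_irr w u : before w u u = false.
Proof. by rewrite /before !ltnn andbF. Qed.

Lemma before_trans w u v z : before w u v -> before w v z -> before w u z.
Proof.
rewrite /before -!(inj_eq val_inj) /=; lia.
Qed.

Lemma before_total w u v : u != v -> before w u v || before w v u.
Proof.
rewrite /before -!(inj_eq val_inj) /=; lia.
Qed.

Definition rank_val w v := #|[set u | before w u v]|.

Lemma rank_val_mono w u v : before w u v -> rank_val w u < rank_val w v.
Proof.
move=> uv; apply/proper_card/properP; split.
  by apply/subsetP => z; rewrite !inE => /before_trans/(_ uv).
by exists u; rewrite inE ?before_irr.
Qed.

Lemma rank_val_lt w v : rank_val w v < n.
Proof.
rewrite -[X in _ < X]card_ord -cardsT; apply/proper_card/properP; split=> //.
by exists v; rewrite ?inE ?before_irr.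
Qed.

Definition rank w v := Ordinal (rank_val_lt w v).

Lemma rank_ltE w u v : (rank w u < rank w v) = before w u v.
Proof.
apply/idP/idP; last exact: rank_val_mono.
have [->|/(before_total w)/orP[//|/rank_val_mono /=]] := eqVneq u v; rewrite ?ltnn //=.
by rewrite /= => h; rewrite ltnNge ltnW.
Qed.

Lemma rank_inj w : injective (rank w).
Proof.
move=> u v e; apply/eqP; apply: contraT => /(before_total w).
by rewrite -!rank_ltE e ltnn.
Qed.

Definition stable_perm w : 'S_n := ((perm (@rank_inj w))^-1)%g.

Lemma stable_permV w v : ((stable_perm w)^-1)%g v = rank w v.
Proof. by rewrite invgK permE. Qed.

Lemma rank_stable_perm w p : rank w (stable_perm w p) = p.
Proof. by rewrite -stable_permV permK. Qed.

Lemma before_stable_perm w p q :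
  before w (stable_perm w p) (stable_perm w q) = (p < q).
Proof. by rewrite -rank_ltE !rank_stable_perm. Qed.

Lemma tnth_descent_word s u : des s = k ->
  tnth (descent_word s) u = des_after s ((s^-1)%g u) :> nat.
Proof. by move=> ds; rewrite tnth_mktuple inordK // ltnS -ds des_after_le. Qed.

Lemma before_descent_word s u v : des s = k ->
  before (descent_word s) u v = ((s^-1)%g u < (s^-1)%g v).
Proof.
move=> ds; rewrite /before -(inj_eq val_inj) /= !tnth_descent_word //.
set p := (s^-1)%g u; set q := (s^-1)%g v.
have -> : u = s p by rewrite permKV.
have -> : v = s q by rewrite permKV.
have [pq|qp|/val_inj->] := ltngtP p q; last by rewrite !ltnn andbF.
- have := des_after_anti s (ltnW pq); rewrite leq_eqVlt => /predU1P[e|->] //.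
  by rewrite e ltnn eqxx (des_after_asc pq) // e.
- have := des_after_anti s (ltnW qp); rewrite leq_eqVlt => /predU1P[e|lt].
    rewrite e ltnn eqxx /=; have := @des_after_asc s q p qp; rewrite e leqnn.
    by move=> /(_ isT)/ltnW; rewrite leqNgt => /negbTE.
  by rewrite ltnNge ltnW // (ltn_eqF lt).
Qed.

Lemma descent_wordK s : des s = k -> stable_perm (descent_word s) = s.
Proof.
move=> ds; apply/(can_inj invgK)/permP => v; rewrite stable_permV.
apply/val_inj; rewrite /= /rank_val.
rewrite -[RHS](@card_ord_below n) 1?ltnW // -[RHS](card_preimset _ (@perm_inj _ (s^-1)%g)).
by apply: eq_card => u; rewrite !inE before_descent_word.
Qed.

Lemma full_descent_word s : des s = k -> full (descent_word s).
Proof.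
move=> ds; apply/forallP => l.
(* At the least such position the count has just dropped from [l + 1] to [l]; the two values around
   this descent are the witnesses. *)
have exP : exists m, des_after s m <= l by exists n; rewrite des_after_last.
case: (ex_minnP exP) => -[|m] lem minm.
  by move: lem; rewrite des_after0 ds leqNgt ltn_ord.
have gtm : l < des_after s m.
  by rewrite ltnNge; apply: contraTN (ltnSn m) => /minm; rewrite -leqNgt.
have lmn : m.+1 < n.
  rewrite ltnNge; apply: contraTN gtm => le; rewrite -leqNgt.
  by rewrite des_after_last.
pose p := Ordinal (ltnW lmn); pose q := Ordinal lmn.
have step := @des_after_step s p q erefl.
have {step} [desc lp lq] : [/\ s q < s p, des_after s p = l.+1 & des_after s q = l].
  by move: step gtm lem => /=; case: (s q < s p) => /=; split; lia.
apply/existsP; exists (s q); apply/existsP; exists (s p).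
by rewrite desc !tnth_descent_word // !permK lp lq !eqxx.
Qed.

Lemma sum_descent_word s : des s = k -> \sum_(l <- descent_word s) l = maj s.
Proof.
move=> ds; rewrite big_tuple -sum_des_after (reindex_inj (@perm_inj _ s)) /=.
by apply: eq_bigr => p _; rewrite tnth_descent_word // permK.
Qed.

(** Between two positions carrying an inversion there is a descent, so their letters differ;
    conversely, a larger letter lies further left. *)
Lemma avoids321_descent_word s : des s = k ->
  avoids321 s = ~~ [exists u : 'I_n, exists v : 'I_n, exists z : 'I_n,
    [&& u < v, v < z, tnth (descent_word s) u < tnth (descent_word s) v
      & tnth (descent_word s) v < tnth (descent_word s) z]].
Proof.
move=> ds; congr (~~ _); apply/existsP/existsP.
  move=> [a /existsP[b /existsP[c /and4P[ab bc ba cb]]]].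
  have dd p q : p < q -> s q < s p -> des_after s q < des_after s p.
    move=> lt gt; rewrite ltnNge; apply: contraTN gt => /(des_after_asc lt).
    by rewrite -leqNgt => /ltnW.
  exists (s c); apply/existsP; exists (s b); apply/existsP; exists (s a).
  by rewrite cb ba !tnth_descent_word // !permK !dd.
move=> [u /existsP[v /existsP[z /and4P[uv vz]]]].
rewrite !tnth_descent_word // => /descent_le_letters h1 /descent_le_letters h2.
exists ((s^-1)%g z); apply/existsP; exists ((s^-1)%g v); apply/existsP.
by exists ((s^-1)%g u); rewrite h1 h2 !permKV uv vz.
Qed.

Lemma stable_perm_step w p q : full w -> p.+1 = q ->
  let s := stable_perm w in
  tnth w (s p) = tnth w (s q) + (s q < s p) :> nat.
Proof.
move=> fw pq s.
have pos u : exists r, u = s r by exists ((s^-1)%g u); rewrite permKV.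
have bE (i j : 'I_n) : (i < j) = before w (s i) (s j) by rewrite before_stable_perm.
have bpq : before w (s p) (s q) by rewrite -bE -pq.
case: (ltngtP (tnth w (s q)) (tnth w (s p))) => [lt|gt|e]; last first.
- move: bpq; rewrite /before e ltnn eq_sym => /= /andP[_ lt].
  by rewrite ltnNge ltnW // addn0.
- by move: bpq; rewrite /before ltnNge ltnW //= -(inj_eq val_inj) ltn_eqF.
have lk : tnth w (s q) < k by have := ltn_ord (tnth w (s p)); lia.
(* With [l] the letter at [q], the value [v] of letter [l + 1] sits at or before [p] and [u] of
   letter [l] at or after [q]. Hence the letter at [p] is [l + 1], and [s q <= u < v <= s p]. *)
have /existsP[u /existsP[v /and3P[uv /eqP/= wu /eqP/= wv]]] := forallP fw (Ordinal lk).
have [[i ui] [j vj]] := (pos u, pos v); subst u v.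
have jq : j < q by rewrite bE /before wv ltnSn.
have jp : j <= p by rewrite -ltnS pq.
have wp : tnth w (s p) = (tnth w (s q)).+1 :> nat.
  move: jp; rewrite leq_eqVlt => /predU1P[/val_inj<-//|].
  by rewrite bE /before -(inj_eq val_inj) /=; lia.
have pi : p < i by rewrite bE /before wp wu ltnSn.
have qi : q <= i by rewrite -pq.
rewrite wp -addn1; congr (_ + _).
have le1 : s q <= s i.
  move: qi; rewrite leq_eqVlt => /predU1P[/val_inj->//|].
  by rewrite bE /before -(inj_eq val_inj) /=; lia.
have le2 : s j <= s p.
  move: jp; rewrite leq_eqVlt => /predU1P[/val_inj->//|].
  by rewrite bE /before -(inj_eq val_inj) /=; lia.
by rewrite (leq_ltn_trans le1) // (leq_trans uv).
Qed.

Lemma des_after_stable_perm w p : full w ->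
  des_after (stable_perm w) p = tnth w (stable_perm w p).
Proof.
move=> fw; set s := stable_perm w.
have bE (i j : 'I_n) : (i < j) = before w (s i) (s j) by rewrite before_stable_perm.
have pos u : exists r, u = s r by exists ((s^-1)%g u); rewrite permKV.
move dE : (n - p) => d; elim: d p dE => [|d IHd] p dE.
  by have := ltn_ord p; lia.
case: (ltnP p.+1 n) => [lt|le].
  pose q := Ordinal lt.
  rewrite (@stable_perm_step w p q) // (@des_after_step _ p q) // IHd //=; lia.
(* At the last position the letter must be 0, since otherwise fullness gives a value with a smaller
   letter, placed still later. *)
rewrite des_after_last //.
case wE : (nat_of_ord (tnth w (s p))) => [//|l].
have lk : l < k by have := ltn_ord (tnth w (s p)); lia.
have /existsP[u /existsP[v /and3P[uv /eqP/= wu /eqP/= wv]]] := forallP fw (Ordinal lk).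
have [r ur] := pos u; have : p < r by rewrite bE /before -ur wu wE ltnSn.
by have := ltn_ord r; lia.
Qed.

Lemma des_stable_perm w : 0 < n -> full w -> des (stable_perm w) = k.
Proof.
move=> n0 fw; set s := stable_perm w.
have bE (i j : 'I_n) : (i < j) = before w (s i) (s j) by rewrite before_stable_perm.
pose p := Ordinal n0.
rewrite -des_after0 -[0]/(nat_of_ord p) des_after_stable_perm // -/s.
have := ltn_ord (tnth w (s p)); rewrite ltnS leq_eqVlt => /predU1P[//|lk].
have /existsP[u /existsP[v /and3P[uv /eqP/= wu /eqP/= wv]]] := forallP fw (Ordinal lk).
suff: (s^-1)%g v < p by [].
by rewrite bE permKV /before wv ltnSn.
Qed.

Lemma stable_permK w : 0 < n -> full w -> descent_word (stable_perm w) = w.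
Proof.
move=> n0 fw; apply: eq_from_tnth => u; apply/val_inj.
rewrite /= tnth_descent_word ?des_stable_perm // des_after_stable_perm //.
by rewrite permKV.
Qed.

Lemma sum_descent_words (V : nmodType) (P : pred 'S_n) (Q : pred (n.-tuple 'I_k.+1))
    (F : nat -> V) : 0 < n ->
    (forall s, des s = k -> P s = Q (descent_word s)) ->
  (\sum_(s | P s && (des s == k)) F (maj s) =
   \sum_(w | Q w && full w) F (\sum_(l <- w) l)%N)%R.
Proof.
move=> n0 PQ.
rewrite (reindex_onto stable_perm descent_word) /=; last first.
  by move=> s /andP[_ /eqP/descent_wordK].
apply: eq_big => w.
  apply/idP/idP => [/andP[/andP[Ps /eqP ds] /eqP e]|/andP[Qw fw]].
    by rewrite -e -PQ // Ps full_descent_word.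
  by rewrite PQ ?des_stable_perm ?stable_permK ?Qw ?eqxx.
by move=> /andP[/andP[_ /eqP ds] /eqP e]; rewrite -sum_descent_word // e.
Qed.

End DescentWord.

(** * Subsequences of tuples and the coefficients of [A321 n 2] *)

Lemma subseq_consP (T : eqType) n (x : T) s m (w : n.-tuple T) :
  reflect (exists u : 'I_n, [/\ m <= u, tnth w u = x & subseq s (drop u.+1 w)])
          (subseq (x :: s) (drop m w)).
Proof.
apply: (iffP idP) => [|[u [le <-] sub]]; last first.
  apply: (@subseq_trans _ (drop u w)); last first.
    by rewrite -(subnK le) -drop_drop drop_subseq.
  rewrite (drop_nth (tnth w u)) ?size_tuple // -tnth_nth /= eqxx.
  exact: sub.
move dE : (n - m) => d; elim: d m dE => [|d IHd] m dE.
  by rewrite drop_oversize // size_tuple; lia.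
have lt : m < n by lia.
rewrite (drop_nth x) ?size_tuple // -[m]/(nat_of_ord (Ordinal lt)) -tnth_nth /=.
case: eqP => [e sub|_ /IHd[|u [le e sub]]]; first by exists (Ordinal lt).
  by lia.
by exists u; split=> //; exact: ltnW.
Qed.

Lemma subseq2P (T : eqType) n (x y : T) (w : n.-tuple T) :
  reflect (exists u v : 'I_n, [/\ u < v, tnth w u = x & tnth w v = y])
          (subseq [:: x; y] w).
Proof.
rewrite -[val w]drop0; apply: (iffP (subseq_consP _ _ _ _)) => [[u [_ wu]]|].
  by case/subseq_consP => v [uv wv _]; exists u, v.
case=> u [v [uv wu wv]]; exists u; split=> //.
by apply/subseq_consP; exists v; split=> //; exact: sub0seq.
Qed.

Lemma subseq3P (T : eqType) n (x y z : T) (w : n.-tuple T) :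
  reflect (exists u v t : 'I_n,
             [/\ u < v, v < t, tnth w u = x, tnth w v = y & tnth w t = z])
          (subseq [:: x; y; z] w).
Proof.
rewrite -[val w]drop0; apply: (iffP (subseq_consP _ _ _ _)) => [[u [_ wu]]|].
  case/subseq_consP => v [uv wv]; case/subseq_consP => t [vt wt _].
  by exists u, v, t.
case=> u [v [t [uv vt wu wv wt]]]; exists u; split=> //.
apply/subseq_consP; exists v; split=> //.
by apply/subseq_consP; exists t; split=> //; exact: sub0seq.
Qed.

Lemma full_subseq n (w : n.-tuple 'I_3) :
  full (k := 2) w =
  subseq [:: letA; letB] w && subseq [:: letB; letC] w.
Proof.
apply/forallP/andP => [fw|[/subseq2P[u [v [uv wu wv]]] /subseq2P[u' [v' [uv' wu' wv']]]]].
  split; apply/subseq2P.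
    have /existsP[u /existsP[v /and3P[uv /eqP wu /eqP wv]]] := fw (@Ordinal 2 0 isT).
    by exists u, v; split=> //; exact/val_inj.
  have /existsP[u /existsP[v /and3P[uv /eqP wu /eqP wv]]] := fw (@Ordinal 2 1 isT).
  by exists u, v; split=> //; exact/val_inj.
case=> [[|[|//]] lt2]; apply/existsP.
  by exists u; apply/existsP; exists v; rewrite uv wu wv.
by exists u'; apply/existsP; exists v'; rewrite uv' wu' wv'.
Qed.

Lemma increasing3_subseq n (w : n.-tuple 'I_3) :
  [exists u : 'I_n, exists v : 'I_n, exists z : 'I_n,
    [&& u < v, v < z, tnth w u < tnth w v & tnth w v < tnth w z]] =
  subseq [:: letA; letB; letC] w.
Proof.
apply/existsP/subseq3P => [[u /existsP[v /existsP[z /and4P[uv vz wuv wvz]]]]|].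
  exists u, v, z; have := ltn_ord (tnth w z).
  by split=> //; apply/val_inj => /=; lia.
case=> u [v [z [uv vz wu wv wz]]].
by exists u; apply/existsP; exists v; apply/existsP; exists z; rewrite uv vz wu wv wz.
Qed.

Lemma coef_A321_2 n s : 0 < n -> ((A321 n 2)`_s)%R = (#|words n s|%:Z)%R.
Proof.
move=> n0; rewrite /A321.
rewrite (sum_descent_words (k := 2)
  (Q := fun w : n.-tuple 'I_3 => ~~ subseq [:: letA; letB; letC] w) _ n0); last first.
  by move=> t dt; rewrite (avoids321_descent_word dt) increasing3_subseq.
rewrite coef_sum -natz -sum1_card natr_sum.
rewrite big_mkcond [RHS]big_mkcond /=; apply: eq_bigr => w _.
rewrite inE full_subseq /admissible coefXn eq_sym.
move: (subseq [:: letA; letB; letC] w) (subseq [:: letA; letB] w)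
  (subseq [:: letB; letC] w) (_ == s).
by case; case; case; case.
Qed.

Theorem mainTheorem3 (n : nat) (hn : (1 <= n)%N) : unimodal (A321 n 2).
Proof.
(* The peak is at [n], the center of the symmetry; beyond it the lowering injection applies
   directly, and below it after reflection to [2 n - i > n]. *)
exists n; split=> i _ lt; rewrite !coef_A321_2 // lez_nat; last first.
  exact: (@card_words_lower n i.+1).
have [le1 le2] : i <= n.*2 /\ i.+1 <= n.*2 by lia.
rewrite (card_words_sym le1) (card_words_sym le2).
have -> : n.*2 - i.+1 = (n.*2 - i).-1 by lia.
by apply: card_words_lower; lia.
Qed.
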